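(* Let $\ell\ge 0$ and let $G$ be a directed path of length $\ell$: $v_0 \rightarrow v_1 \rightarrow \cdots \rightarrow v_\ell$ (that is, $G$ has pairwise distinct vertices $v_0,\dots,v_\ell$ and edge set exactly $\{(v_i,v_{i+1}) : 0\le i<\ell\}$). The associative spectrum of the corresponding graph algebra is \[ s_n(\mathbb{A}(G))= \begin{cases} D_\ell(n), & \text{if } n \leq \ell+1,\\ D_\ell(n)+1, & \text{if } n \geq \ell+2, \end{cases} \] for all integers $n\ge 1$, where $D_\ell(n)$ is the number of DFS trees of size $n$ of height at most $\ell$.
   Context: Graph algebra of a digraph $G=(V,E)$: $\mathbb{A}(G)=(V\cup\{\infty\};\circ,\infty)$ with $\infty\notin V$, where $x\circ y=x$ if $(x,y)\in E$ and $x\circ y=\infty$ otherwise. $B_n$ is the set of bracketings of size $n$: groupoid terms obtained from the string $x_1x_2\cdots x_n$ of distinct variables (in this order) by inserting parentheses so that the product is unambiguous. $s_n(\mathbb{A}(G))$ is the number of distinct $n$-ary operations on $V\cup\{\infty\}$ induced by the elements of $B_n$; the sequence $(s_n)_{n\ge 1}$ is the associative spectrum. A DFS tree of size $n$ is a rooted directed tree $T$ (edges directed away from the root) on the vertex set $X_n=\{x_1,\dots,x_n\}$ with root $x_1$ such that for every $x_i$, the set consisting of $x_i$ and all its descendants is of the form $\{x_j : i\le j\le i'\}$ for some $i'$ with $i\le i'\le n$. The depth of a vertex is the length (number of edges) of the path from the root to it; the height of $T$ is the maximum depth of its vertices. *)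

(* Defs.v *)
From HB Require Import structures.
From mathcomp Require Import all_boot.
From mathcomp Require Import boolp classical_sets.

Set Implicit Arguments.
Unset Strict Implicit.
Unset Printing Implicit Defensive.

Inductive term (X : Type) : Type :=
| Var of X
| App of term X & term X.

Fixpoint leaves (X : Type) (t : term X) : seq X :=
  match t with
  | Var x => [:: x]
  | App t1 t2 => leaves t1 ++ leaves t2
  end.

Fixpoint eval (X A : Type) (op : A -> A -> A) (h : X -> A) (t : term X) : A :=
  match t with
  | Var x => h x
  | App t1 t2 => op (eval op h t1) (eval op h t2)
  end.

(* The variables x_1, ..., x_n are the elements 0, ..., n-1 of 'I_n, which
   [enum 'I_n] lists in increasing order. *)
Definition bracketing (n : nat) (t : term 'I_n) : Prop := leaves t = enum 'I_n.

Definition term_op (n : nat) (A : finType) (op : A -> A -> A) (t : term 'I_n) :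
    {ffun {ffun 'I_n -> A} -> A} :=
  [ffun h : {ffun 'I_n -> A} => eval op h t].

Definition assoc_spectrum (A : finType) (op : A -> A -> A) (n : nat) : nat :=
  #|[set f : {ffun {ffun 'I_n -> A} -> A} |
      `[< exists2 t : term 'I_n, bracketing t & f = term_op op t >] ]|.

(* [None] plays the role of the extra element infinity. *)
Definition graph_op (V : Type) (E : rel V) (x y : option V) : option V :=
  match x, y with
  | Some u, Some v => if E u v then Some u else None
  | _, _ => None
  end.

Definition directed_path (l : nat) (V : Type) (E : rel V) : Prop :=
  exists v : 'I_l.+1 -> V,
    bijective v /\ forall i j : 'I_l.+1, E (v i) (v j) = (j == i.+1 :> nat).

Section RootedTrees.
Variables (V : finType) (e : rel V) (r : V).

Definition path_from_to (v : V) (p : seq V) : Prop :=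
  path e r p /\ last r p = v.

(* These paths may repeat vertices, so uniqueness (also for v = r) excludes
   every directed cycle, loops and edges into the root. *)
Definition rooted_tree : Prop := forall v : V, exists! p, path_from_to v p.

(* The path is the list of vertices after r, so its size counts edges. *)
Definition depth (v : V) : nat := size (xget [::] (path_from_to v)).

Definition height : nat := \max_(v : V) depth v.

End RootedTrees.

Definition edge (V : finType) (T : {set V * V}) : rel V :=
  fun x y => (x, y) \in T.

(* The vertices x_1, ..., x_n.+1 are 0, ..., n in 'I_n.+1. *)
Definition dfs_tree (n : nat) (T : {set 'I_n.+1 * 'I_n.+1}) : Prop :=
  rooted_tree (edge T) ord0 /\
  forall i : 'I_n.+1, exists2 i' : 'I_n.+1, i <= i' &
    forall j : 'I_n.+1, connect (edge T) i j = (i <= j <= i').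

Definition num_dfs_trees (l n : nat) : nat :=
  if n is m.+1 then
    #|[set T : {set 'I_m.+1 * 'I_m.+1} |
        `[< dfs_tree T /\ height (edge T) ord0 <= l >] ]|
  else 0.

(* Main.v *)
Require Import Defs.
From mathcomp Require Import all_boot.
From mathcomp Require Import boolp classical_sets zify.

Set Implicit Arguments.
Unset Strict Implicit.
Unset Printing Implicit Defensive.

(** Both sides of the formula are counted by the depth sequences: the
sequences d_1 ... d_n of natural numbers with d_1 = 0 and
0 < d_(i+1) <= d_i + 1.

On the side of the terms, a bracketing makes x_1, ..., x_n into a tree, in
which every product t1 t2 contributes an edge from the leftmost variable of t1
to that of t2.  In a graph algebra the value of the term under an assignment h
is h(x_1) if h is a homomorphism from this tree to the graph, and infinity
otherwise.  In a directed path a homomorphism just adds the depth of a variable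
to the level of h(x_1), so the term operation depends only on the sequence of
depths ([leaf_depths], [term_opE]), and bracketings realise exactly the depth
sequences ([depth_seq_leaf_depthsE]).  A sequence bounded by l can be recovered
from its operation, by assigning to each variable the vertex of the path given
by its depth ([path_op_witness]).  A sequence exceeding l admits no
homomorphism, so all of these induce the same constant operation infinity
([path_op_None]); they exist if and only if n >= l + 2, since the largest
possible depth is n - 1, attained by 0, 1, ..., n - 1.

On the side of the trees, the vertices after x_i that are deeper than x_i, up
to the first one that is not, are the descendants of x_i in a DFS tree.  Hence
(x_i, x_j) is an edge if and only if i < j, d_j = d_i + 1 and d_k > d_i for
i < k <= j, which reconstructs the tree from its depths ([dfs_tree_depthE]);
conversely this rule turns each depth sequence into a DFS tree with these
depths ([dfs_depth_tree], [depth_depth_tree]).  Thus D_l(n) is the number of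
depth sequences bounded by l ([num_dfs_treesE]). *)

(** * Depth sequences *)

Definition depth_step (a b : nat) : bool := 0 < b <= a.+1.

Definition depth_seq (s : seq nat) : bool :=
  if s is d :: s' then (d == 0) && path depth_step d s' else false.

Lemma depth_seqP (m : nat) (s : seq nat) : size s = m.+1 ->
  reflect (nth 0 s 0 = 0 /\
           forall i, i < m -> depth_step (nth 0 s i) (nth 0 s i.+1))
          (depth_seq s).
Proof.
case: s => [|d s] //= [sz]; apply: (iffP andP).
  move=> [/eqP d0 /(pathP 0) H]; split=> // i lt_im.
  by have := H i; rewrite sz => /(_ lt_im).
move=> [d0 H]; split; first exact/eqP.
by apply/(pathP 0) => i; rewrite sz => /H.
Qed.

Lemma depth_seq_rcons (s : seq nat) (d : nat) : s != [::] ->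
  depth_seq (rcons s d) = depth_seq s && depth_step (last 0 s) d.
Proof. by case: s => //= a s _; rewrite rcons_path andbA. Qed.

Lemma depth_seq_nth_le (s : seq nat) (i : nat) : depth_seq s -> nth 0 s i <= i.
Proof.
move=> ds; case: (ltnP i (size s)) => [|le_si]; last by rewrite nth_default.
case: s ds => // a s /(@depth_seqP (size s) (a :: s) erefl) [d0 step] /=.
elim: i => [|i IH] lti; first by rewrite d0.
have := step i; rewrite /depth_step => /(_ lti) /andP[_ H].
apply: (leq_trans H); rewrite ltnS; exact: IH (ltnW lti).
Qed.

Lemma depth_seq_iota (m : nat) : depth_seq (iota 0 m.+1).
Proof.
apply/(depth_seqP (size_iota _ _)); split=> // i lt_im.
by rewrite !nth_iota ?add0n /depth_step ?leqnn // ltnW.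
Qed.

(** * Bracketings and depth sequences *)

(** The depths, in the tree of a term described above, of its leaves from left
to right: a product hangs the root of the tree of [t2] below that of [t1]. *)
Fixpoint leaf_depths (X : Type) (t : term X) : seq nat :=
  match t with
  | Var _ => [:: 0]
  | App t1 t2 => leaf_depths t1 ++ map S (leaf_depths t2)
  end.

Lemma size_leaf_depths (X : Type) (t : term X) :
  size (leaf_depths t) = size (leaves t).
Proof. by elim: t => //= t1 IH1 t2 IH2; rewrite !size_cat size_map IH1 IH2. Qed.

Lemma depth_seq_leaf_depths (X : Type) (t : term X) :
  depth_seq (leaf_depths t).
Proof.
elim: t => //= t1 IH1 t2 IH2.
case: (leaf_depths t1) IH1 => //= a s1 /andP[-> p1].
case: (leaf_depths t2) IH2 => //= b s2 /andP[/eqP -> p2].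
rewrite cat_path p1 /=; have -> := @path_map _ _ S depth_step 0 s2.
by apply: sub_path p2 => x y /andP[].
Qed.

(** A leaf of depth d is added on the right by multiplying with it the subterm
that is met after d - 1 steps to the right child; the rightmost branch is long
enough exactly when d is at most one more than the depth of the last leaf. *)
Lemma graft_leaf (X : Type) (x : X) (t : term X) (d : nat) :
  depth_step (last 0 (leaf_depths t)) d ->
  exists2 t', leaves t' = rcons (leaves t) x
            & leaf_depths t' = rcons (leaf_depths t) d.
Proof.
elim: t d => [y|t1 _ t2 IH] [|[|d]] //=.
- by exists (App (Var y) (Var x)).
- by exists (App (App t1 t2) (Var x)); rewrite /= cats1.
rewrite last_cat => step.
have [] := IH d.+1.
  (* [leaf_depths t2] is nonempty, so the default of [last] is irrelevant. *)
  have := depth_seq_leaf_depths t2; case: (leaf_depths t2) step => //= a s.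
  by rewrite (last_map S) /depth_step /=; case: (last a s).
move=> t' lt' dt'; exists (App t1 t'); rewrite /= ?lt' ?dt' -?rcons_cat //.
by rewrite map_rcons rcons_cat.
Qed.

Lemma depth_seq_leaf_depthsE (X : Type) (xs : seq X) (s : seq nat) :
  size xs = size s -> depth_seq s ->
  exists2 t, leaves t = xs & leaf_depths t = s.
Proof.
elim/last_ind: s xs => // s d IH xs.
case/lastP: xs => [|xs x]; rewrite !size_rcons // => -[sz].
have [s0 /=|nz] := eqVneq s [::].
  move: sz; rewrite s0; case: xs => //= _; rewrite andbT => /eqP ->.
  by exists (Var x).
rewrite depth_seq_rcons // => /andP[/(IH _ sz) [t <- <-]].
by move=> /(graft_leaf x).
Qed.

(** * Term operations over a directed path *)

Lemma all2_map_r (X Y : Type) (r : X -> Y -> bool) (f : X -> Y) (s : seq X) :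
  all2 r s (map f s) = all (fun x => r x (f x)) s.
Proof. by elim: s => //= x s ->. Qed.

Lemma all2_map2 (X Y Z : Type) (r : X -> Z -> bool) (f : Y -> Z)
    (s : seq X) (s' : seq Y) :
  all2 r s (map f s') = all2 (fun x y => r x (f y)) s s'.
Proof. by elim: s s' => [|x s IH] [|y s'] //=; rewrite IH. Qed.

Lemma all2_cat (X Y : Type) (r : X -> Y -> bool) (s1 s2 : seq X)
    (t1 t2 : seq Y) : size s1 = size t1 ->
  all2 r (s1 ++ s2) (t1 ++ t2) = all2 r s1 t1 && all2 r s2 t2.
Proof.
by elim: s1 t1 => [|x s1 IH] [|y t1] //= [/IH ->]; rewrite andbA.
Qed.

Definition on_level (V : Type) (l : nat) (g : V -> 'I_l.+1)
    (k : nat) (a : option V) : bool :=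
  if a is Some u then g u == k :> nat else false.

(** Here [g] sends the vertex v_i of the path to i. *)
Section PathOperations.
Variables (l : nat) (V : finType) (E : rel V) (g : V -> 'I_l.+1).
Hypothesis edgeE : forall u v, E u v = (g v == (g u).+1 :> nat).

(** The homomorphism criterion, specialised to a path: evaluating to the vertex
v_k forces each variable to lie on the level k plus its depth.  Since k varies,
this determines the value of the term completely. *)
Lemma on_level_eval (X : Type) (h : X -> option V) (t : term X) (k : nat) :
  on_level g k (eval (graph_op E) h t) =
  all2 (fun x d => on_level g (k + d) (h x)) (leaves t) (leaf_depths t).
Proof.
elim: t k => [x|t1 IH1 t2 IH2] k /=; first by rewrite addn0 andbT.
rewrite all2_cat ?size_leaf_depths // -IH1 all2_map2.
transitivity (on_level g k (eval (graph_op E) h t1) &&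
              on_level g k.+1 (eval (graph_op E) h t2)).
  case: (eval _ h t1) => [u|] //=; case: (eval _ h t2) => [w|] /=;
    last by rewrite andbF.
  rewrite edgeE; case: (eqVneq (g u : nat) k) => [<-|ne] /=.
    by case: (g w == _ :> nat); rewrite /= ?eqxx.
  by case: (g w == _ :> nat); rewrite //=; apply/negbTE.
rewrite IH2; congr (_ && _).
apply/esym; elim: (leaves t2) (leaf_depths t2) => [|x xs IH] [|d ds] //=.
by rewrite addnS IH.
Qed.

(** The operation that a term with depths [d] induces, in a form from which the
term has disappeared. *)
Definition path_op (m : nat) (d : nat -> nat) :
    {ffun {ffun 'I_m.+1 -> option V} -> option V} :=
  [ffun h : {ffun 'I_m.+1 -> option V} =>
     if h ord0 is Some u then
       if [forall i : 'I_m.+1, on_level g (g u + d i) (h i)] then Some u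
       else None
     else None].

Hypothesis g_inj : injective g.

Lemma term_opE (m : nat) (t : term 'I_m.+1) : bracketing t ->
  term_op (graph_op E) t = path_op m (nth 0 (leaf_depths t)).
Proof.
move=> bt; apply/ffunP => h; rewrite !ffunE.
have sz : size (leaf_depths t) = m.+1.
  by rewrite size_leaf_depths bt size_enum_ord.
have [d0 _] := depth_seqP sz (depth_seq_leaf_depths t).
set d := nth 0 _ in d0 *.
have lev k : on_level g k (eval (graph_op E) h t) =
    [forall i : 'I_m.+1, on_level g (k + d i) (h i)].
  rewrite on_level_eval bt.
  have -> : leaf_depths t = map (fun i : 'I_m.+1 => d i) (enum 'I_m.+1).
    rewrite (map_comp d val) val_enum_ord; apply: (@eq_from_nth _ 0).
      by rewrite size_map size_iota.
    move=> i; rewrite sz => lti.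
    by rewrite (nth_map 0) ?size_iota // nth_iota.
  rewrite all2_map_r; apply/allP/forallP => H i; last by move=> _; apply: H.
  by apply: H; rewrite mem_enum.
case ev : (eval _ h t) lev => [u|] lev.
  have := esym (lev (g u)); rewrite /= eqxx => /forallP H.
  have := H ord0; rewrite /= d0 addn0.
  case: (h ord0) => //= w /eqP /val_inj /g_inj ->.
  by have /forallP -> := H.
by case: (h ord0) => // u; rewrite -lev.
Qed.

Lemma path_op_None (m : nat) (d : nat -> nat) (i : 'I_m.+1) : l < d i ->
  path_op m d = [ffun=> None].
Proof.
move=> ltl; apply/ffunP => h; rewrite !ffunE.
case: (h ord0) => // u; case: ifP => // /forallP /(_ i).
case: (h i) => //= w /eqP gw; have := ltn_ord (g w); rewrite gw; lia.
Qed.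

Hypothesis g_surj : forall k : 'I_l.+1, exists u, g u = k.

(** Walking down the path from v_0 according to [d] gives an assignment on
which [path_op d] is defined; as it fixes the level of every variable, it
makes no other [path_op d'] defined. *)
Lemma path_op_witness (m : nat) (d : nat -> nat) :
  d 0 = 0 -> (forall i : 'I_m.+1, d i <= l) ->
  exists h, forall d', path_op m d' h != None <->
                       forall i : 'I_m.+1, d' i = d i.
Proof.
move=> d0 dl.
have /fin_all_exists [u gu] : forall i : 'I_m.+1, exists u, g u = d i :> nat.
  move=> i; have lti : d i < l.+1 by rewrite ltnS.
  by have [w gw] := g_surj (Ordinal lti); exists w; rewrite gw.
exists [ffun i : 'I_m.+1 => Some (u i)] => d'; rewrite !ffunE.
case: ifP => [/forallP H|/negbT/forallPn [i]].
  by split=> // _ i; have := H i; rewrite ffunE /= !gu d0 => /eqP.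
rewrite ffunE /= !gu d0 => ne; split=> // H.
by rewrite H eqxx in ne.
Qed.

End PathOperations.

(** * DFS trees and depth sequences *)

Section RootedTreeDepth.
Variables (V : finType) (e : rel V) (r : V).
Hypothesis tree : rooted_tree e r.

Lemma size_path_depth (p : seq V) : path e r p -> depth e r (last r p) = size p.
Proof.
move=> pp; have [q [_ uq]] := tree (last r p).
have pfp : path_from_to e r (last r p) p by [].
by rewrite /depth -(uq _ (xgetI [::] pfp)) (uq p).
Qed.

Lemma depth_edge (x y : V) : e x y -> depth e r y = (depth e r x).+1.
Proof.
move=> xy; have [p [[pp lp] _]] := tree x.
have := @size_path_depth (rcons p y); rewrite last_rcons rcons_path lp pp xy.
by rewrite size_rcons -lp size_path_depth // => ->.
Qed.

Lemma depth_root : depth e r r = 0.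
Proof. exact: (@size_path_depth [::]). Qed.

Lemma has_parent (y : V) : y != r -> exists x, e x y.
Proof.
move=> yr; have [p [[]]] := tree y; case/lastP: p => [_ /= ry|p z].
  by rewrite ry eqxx in yr.
by rewrite rcons_path last_rcons => /andP[_ ez] <- _; exists (last r p).
Qed.

Lemma depth_connect (x y : V) : connect e x y -> x != y ->
  depth e r x < depth e r y.
Proof.
move=> /connectP[p]; elim/last_ind: p y => [y _ -> /[!eqxx] //|p z IH y].
rewrite rcons_path last_rcons => /andP[pp ez] -> _.
rewrite (depth_edge ez) ltnS.
have [<-//|ne] := eqVneq x (last x p).
exact: ltnW (IH _ pp _ ne).
Qed.

End RootedTreeDepth.

(** For the depth function of a DFS tree, this says that [j] lies before the end
of the interval of descendants of [i] (given i <= j). *)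
Definition exceeds (d : nat -> nat) (i j : nat) : bool :=
  all (fun k => d i < d k) (index_iota i.+1 j.+1).

Lemma exceedsP (d : nat -> nat) (i j : nat) :
  reflect (forall k, i < k <= j -> d i < d k) (exceeds d i j).
Proof.
by apply: (iffP allP) => H k Hk; apply: H; move: Hk; rewrite mem_index_iota.
Qed.

Definition depth_tree (m : nat) (d : nat -> nat) :
    {set 'I_m.+1 * 'I_m.+1} :=
  [set e : 'I_m.+1 * 'I_m.+1 |
    [&& e.1 < e.2, d e.2 == (d e.1).+1 & exceeds d e.1 e.2]].

Section DepthsOfTree.
Variables (m : nat) (T : {set 'I_m.+1 * 'I_m.+1}).
Hypothesis dfsT : dfs_tree T.

Let dep (i : nat) : nat := depth (edge T) ord0 (inord i : 'I_m.+1).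

(** The descendants of [i] form an interval starting at [i]; it contains [j],
hence everything in between, and descendants are strictly deeper. *)
Lemma dfs_edge (i j : 'I_m.+1) : edge T i j -> i < j /\ exceeds dep i j.
Proof.
move=> eij; have [tree int] := dfsT; have [i' lei Hi] := int i.
have cij := connect1 eij.
have /andP[leij leji'] : i <= j <= i' by rewrite -Hi.
have ne : i != j.
  apply/eqP => ij; have := depth_edge tree eij; rewrite ij; lia.
split; first by rewrite ltn_neqAle ne.
apply/exceedsP => k /andP[ik kj].
have ltk : k < m.+1 by apply: leq_ltn_trans kj (ltn_ord j).
have ck : connect (edge T) i (Ordinal ltk).
  by rewrite Hi /= (ltnW ik) (leq_trans kj).
rewrite /dep inord_val -[k]/(val (Ordinal ltk)) inord_val.
by apply: (depth_connect tree ck); apply/eqP => /(congr1 val) /=; lia.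
Qed.

(** If [i] and [j] satisfy the three conditions, then so do the parent [p] of
[j] and [j]; but two distinct vertices of equal depth cannot both stay below
everything up to [j], as the later one belongs to the range of the earlier. *)
Lemma dfs_tree_depthE : T = depth_tree m dep.
Proof.
have [tree _] := dfsT.
apply/setP => -[i j]; rewrite inE /=; apply/idP/and3P => [eij|[ij dj exc]].
  have [lt exc] := dfs_edge eij; split=> //.
  by rewrite /dep !inord_val (depth_edge tree eij).
have j0 : j != ord0 by apply/eqP => j0; rewrite j0 in ij.
have [p epj] := has_parent tree j0.
have [pj excp] := dfs_edge epj.
have dp : dep p = dep i.
  by apply: succn_inj; rewrite -(eqP dj) /dep !inord_val (depth_edge tree epj).
suff <- : p = i by [].
apply/val_inj; case: (ltngtP p i) => // lt.
  by have := exceedsP _ _ _ excp i; rewrite lt (ltnW ij) dp ltnn => /(_ isT).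
by have := exceedsP _ _ _ exc p; rewrite lt (ltnW pj) dp ltnn => /(_ isT).
Qed.

(** The parent of i + 1 is i, or else it is an earlier vertex, whose descendants
include i because they form an interval. *)
Lemma dfs_depth_step (i : nat) : i < m -> depth_step (dep i) (dep i.+1).
Proof.
move=> im; have [tree _] := dfsT.
pose j : 'I_m.+1 := inord i.+1.
have jE : j = i.+1 :> nat by rewrite inordK.
have j0 : j != ord0 by apply/eqP => /(congr1 val) /=; rewrite jE.
have [p epj] := has_parent tree j0.
have [pj exc] := dfs_edge epj.
have dj : dep i.+1 = (dep p).+1.
  by rewrite /dep inord_val (depth_edge tree epj).
rewrite /depth_step dj /= ltnS.
have [->//|ne] := eqVneq (p : nat) i.
by apply/ltnW/(exceedsP _ _ _ exc); lia.
Qed.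

End DepthsOfTree.

Section TreeOfDepths.
Variables (m : nat) (d : nat -> nat).
Hypothesis d0 : d 0 = 0.
Hypothesis dS : forall i, i < m -> depth_step (d i) (d i.+1).

Let T := depth_tree m d.

Lemma depth_tree_edgeP (i j : 'I_m.+1) :
  reflect [/\ i < j, d j = (d i).+1 & forall k, i < k <= j -> d i < d k]
          (edge T i j).
Proof.
rewrite /edge inE /=; apply: (iffP and3P) => -[ij dj exc]; split=> //.
- exact/eqP.
- exact/exceedsP.
- exact/eqP.
exact/exceedsP.
Qed.

(** The parent of [j] is the last earlier vertex [i] of smaller depth.  All later
ones up to [j] have depth at least [d j]; this holds for i + 1 in particular,
and depths grow by at most 1, so [d j] is [d i + 1]. *)
Lemma depth_tree_parent (j : 'I_m.+1) : j != ord0 ->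
  exists i : 'I_m.+1, edge T i j.
Proof.
move=> j0; have jgt0 : 0 < j by rewrite lt0n.
have dj : 0 < d j.
  have := @dS j.-1; rewrite prednK //; have := ltn_ord j.
  by move=> lt /(_ ltac:(lia)) /andP[].
pose P k := (k < j) && (d k < d j).
have exP : exists k, P k by exists 0; rewrite /P jgt0 d0.
have ubP k : P k -> k <= j by move=> /andP[/ltnW].
case: (ex_maxnP exP ubP) => i /andP[ij dij] max_i.
have later k : i < k -> k <= j -> d j <= d k.
  move=> ik; rewrite leq_eqVlt => /orP[/eqP->//|kj].
  rewrite leqNgt; apply/negP => dkj.
  by have := max_i k; rewrite /P kj dkj => /(_ isT); rewrite leqNgt ik.
have im : i < m by have := ltn_ord j; lia.
have im1 : i < m.+1 by lia.
exists (Ordinal im1); apply/depth_tree_edgeP; split=> //=.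
  have := dS im => /andP[_ h1]; have h2 := later _ (leqnn _) ij; lia.
by move=> k /andP[ik kj]; apply: leq_trans dij (later _ ik kj).
Qed.

Lemma depth_tree_parent_uniq (i i' j : 'I_m.+1) :
  edge T i j -> edge T i' j -> i = i'.
Proof.
move=> /depth_tree_edgeP[ij dj ex] /depth_tree_edgeP[ij' dj' ex'].
apply/val_inj => /=; case: (ltngtP i i') => // lt.
  by have := ex i'; rewrite lt (ltnW ij') => /(_ isT); lia.
by have := ex' i; rewrite lt (ltnW ij) => /(_ isT); lia.
Qed.

Lemma depth_tree_rooted : rooted_tree (edge T) ord0.
Proof.
move=> v; have [n] := ubnP (v : nat); elim: n v => // n IH v /ltnSE vn.
have [->|v0] := eqVneq v ord0.
  exists [::]; split=> // q [pq lq].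
  case/lastP: q pq lq => // q z.
  rewrite rcons_path last_rcons => /andP[_ ez] zE.
  by have [] := depth_tree_edgeP _ _ ez; rewrite zE.
have [p epv] := depth_tree_parent v0.
have [pv _ _] := depth_tree_edgeP _ _ epv.
have [q [[pq lq] uq]] := IH p (leq_trans pv vn).
exists (rcons q v); split.
  by split; rewrite ?rcons_path ?last_rcons // pq lq.
move=> q'; case/lastP: q' => [[_ /= h]|q' z [+ +]].
  by rewrite -h eqxx in v0.
rewrite rcons_path last_rcons => /andP[pq' ez] zv; rewrite zv in ez *.
by rewrite (uq q') //; split=> //; apply: depth_tree_parent_uniq ez epv.
Qed.

Lemma depth_depth_tree (i : 'I_m.+1) : depth (edge T) ord0 i = d i.
Proof.
have [p [[pp <-] _]] := depth_tree_rooted i.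
rewrite (size_path_depth depth_tree_rooted pp).
elim/last_ind: p pp => [|p z IH] /=; first by rewrite d0.
rewrite rcons_path last_rcons size_rcons => /andP[pp ez].
by have [_ -> _] := depth_tree_edgeP _ _ ez; rewrite IH.
Qed.

(** For the implication from right to left, climb from [j] to its parent: the
climb cannot jump over [i], as the depth of [i] would then lie strictly between
that of the parent and that of [j], which differ by 1. *)
Lemma depth_tree_connect (i j : 'I_m.+1) :
  connect (edge T) i j = (i <= j) && exceeds d i j.
Proof.
apply/idP/andP => [/connectP[p]|[]].
  elim/last_ind: p j => [j _ /= ->|p z IH j].
    by split=> //; apply/exceedsP => k; lia.
  rewrite rcons_path last_rcons => /andP[pp ez] ->.
  have [le /exceedsP exc] := IH _ pp erefl.
  have [lt _ exz] := depth_tree_edgeP _ _ ez.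
  split; first by lia.
  apply/exceedsP => k /andP[ik kz].
  case: (leqP k (last i p)) => [kl|lk]; first by apply: exc; rewrite ik.
  apply: leq_ltn_trans (exz k _); last by rewrite lk.
  move: le; rewrite leq_eqVlt => /orP[/eqP <-//|il].
  by apply/ltnW/exc; rewrite il leqnn.
have [n] := ubnP (j : nat); elim: n j => // n IH j /ltnSE jn.
move=> le /exceedsP exc.
have [->//|ne] := eqVneq i j.
have ij : i < j by rewrite ltn_neqAle ne.
have j0 : j != ord0 by rewrite -val_eqE /=; lia.
have [p epj] := depth_tree_parent j0.
have [pj dj exp] := depth_tree_edgeP _ _ epj.
have ip : i <= p.
  rewrite leqNgt; apply/negP => pi.
  have := exp i; rewrite pi (ltnW ij) => /(_ isT).
  by have := exc j; rewrite ij leqnn => /(_ isT); lia.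
apply: connect_trans (connect1 epj); apply: IH => //; first by lia.
by apply/exceedsP => k /andP[ik kp]; apply: exc; lia.
Qed.

Lemma dfs_depth_tree : dfs_tree T.
Proof.
split; first exact: depth_tree_rooted.
move=> i; pose below (j : 'I_m.+1) := (i <= j) && exceeds d i j.
have refl : below i by rewrite /below leqnn; apply/exceedsP => k; lia.
case: (@arg_maxnP _ i below val refl) => i' /andP[le exc] max_i.
exists i' => // j; rewrite depth_tree_connect; apply/idP/idP.
  by move=> H; case/andP: (H) => -> _ /=; apply: max_i.
move=> /andP[-> ji']; apply/exceedsP => k /andP[ik kj].
by apply: (exceedsP _ _ _ exc); rewrite ik (leq_trans kj).
Qed.

End TreeOfDepths.

(** * Counting *)

(** Tuples over ['I_l.+1] put the depth sequences bounded by [l] into a finite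
type. *)
Definition bounded_depth_seqs (l m : nat) : {set m.+1.-tuple 'I_l.+1} :=
  [set s : m.+1.-tuple 'I_l.+1 | depth_seq (map val s)].

Lemma bounded_depth_seqP (l m : nat) (s : m.+1.-tuple 'I_l.+1) :
  s \in bounded_depth_seqs l m ->
  nth 0 (map val s) 0 = 0 /\
  forall i, i < m ->
    depth_step (nth 0 (map val s) i) (nth 0 (map val s) i.+1).
Proof.
rewrite inE => ds; apply/depth_seqP => //.
by rewrite size_map size_tuple.
Qed.

Lemma eq_from_depths (l m : nat) (s s' : m.+1.-tuple 'I_l.+1) :
  (forall i : 'I_m.+1, nth 0 (map val s) i = nth 0 (map val s') i) -> s = s'.
Proof.
move=> H; apply/val_inj/(inj_map val_inj)/(@eq_from_nth _ 0).
  by rewrite !size_map !size_tuple.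
by move=> i; rewrite size_map size_tuple => lti; apply: (H (Ordinal lti)).
Qed.

Lemma nth_bounded (l m : nat) (s : m.+1.-tuple 'I_l.+1) (i : nat) :
  nth 0 (map val s) i <= l.
Proof.
case: (ltnP i (size s)) => [lti|?]; last by rewrite nth_default ?size_map.
by rewrite (nth_map ord0) // -ltnS ltn_ord.
Qed.

Lemma bounded_tuple (l m : nat) (s : seq nat) : size s = m.+1 ->
  (forall i, i < m.+1 -> nth 0 s i <= l) ->
  exists s' : m.+1.-tuple 'I_l.+1, map val s' = s.
Proof.
move=> sz le; exists [tuple inord (nth 0 s i) | i < m.+1].
rewrite -map_comp; apply: (@eq_from_nth _ 0).
  by rewrite size_map size_enum_ord sz.
move=> i; rewrite size_map size_enum_ord => lti.
rewrite (nth_map ord0) ?size_enum_ord //= inordK; first by rewrite nth_enum_ord.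
by rewrite ltnS nth_enum_ord // le.
Qed.

Lemma num_dfs_treesE (l m : nat) :
  num_dfs_trees l m.+1 = #|bounded_depth_seqs l m|.
Proof.
rewrite /num_dfs_trees.
pose F (s : m.+1.-tuple 'I_l.+1) := depth_tree m (nth 0 (map val s)).
rewrite -(@card_in_imset _ _ F (bounded_depth_seqs l m)); last first.
  move=> s s' /bounded_depth_seqP [s0 sS] /bounded_depth_seqP [s0' sS'] eqF.
  apply: eq_from_depths => i.
  by rewrite -(depth_depth_tree s0 sS) -(depth_depth_tree s0' sS') -/(F s) eqF.
apply: eq_card => T; rewrite inE; apply/asboolP/imsetP; last first.
  move=> [s /bounded_depth_seqP [s0 sS] ->].
  split; first exact: dfs_depth_tree.
  by apply/bigmax_leqP => i _; rewrite depth_depth_tree // nth_bounded.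
move=> [dfsT /bigmax_leqP hT].
pose dep i := depth (edge T) ord0 (inord i : 'I_m.+1).
have nthE i : i < m.+1 -> nth 0 (mkseq dep m.+1) i = dep i by exact: nth_mkseq.
have [s sE] : exists s : m.+1.-tuple 'I_l.+1, map val s = mkseq dep m.+1.
  by apply: bounded_tuple => [|i /nthE ->]; [rewrite size_mkseq | apply: hT].
exists s.
  rewrite inE sE; apply/(depth_seqP (size_mkseq _ _)); split.
    rewrite nthE // /dep.
    have -> : inord 0 = ord0 :> 'I_m.+1 by apply/val_inj; rewrite /= inordK.
    by rewrite depth_root //; case: dfsT.
  by move=> i im; rewrite !nthE //; [apply: dfs_depth_step | lia].
rewrite /F sE {1}(dfs_tree_depthE dfsT) -/dep.
apply/setP => -[i j]; rewrite !inE /= !nthE //.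
apply: andb_id2l => ij; congr (_ && _).
apply/exceedsP/exceedsP => H k Hk; have := H k Hk; have := ltn_ord j;
  move=> jm; rewrite !nthE //; lia.
Qed.

Lemma directed_path_level (l : nat) (V : finType) (E : rel V) :
  directed_path l E ->
  exists g : V -> 'I_l.+1,
    bijective g /\ forall u w, E u w = (g w == (g u).+1 :> nat).
Proof.
move=> [v [[g vK gK] Ev]]; exists g; split; first by exists v.
by move=> u w; rewrite -Ev !gK.
Qed.

Lemma term_ops_path (l m : nat) (V : finType) (E : rel V) (g : V -> 'I_l.+1)
    (f : {ffun {ffun 'I_m.+1 -> option V} -> option V}) :
    injective g -> (forall u w, E u w = (g w == (g u).+1 :> nat)) ->
  (exists2 t : term 'I_m.+1, bracketing t & f = term_op (graph_op E) t) <->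
  (exists2 s, size s = m.+1 /\ depth_seq s & f = path_op g m (nth 0 s)).
Proof.
move=> g_inj edgeE; split=> [[t bt ->]|[s [sz ds] ->]].
  exists (leaf_depths t); last exact: term_opE.
  by rewrite depth_seq_leaf_depths size_leaf_depths bt size_enum_ord.
have := @depth_seq_leaf_depthsE _ (enum 'I_m.+1) s.
rewrite size_enum_ord sz => /(_ erefl ds) [t bt <-].
by exists t => //; rewrite (term_opE edgeE).
Qed.

Theorem proposition5p1 (l : nat) (V : finType) (E : rel V)
    (hG : directed_path l E) (n : nat) (hn : 1 <= n) :
  assoc_spectrum (graph_op E) n =
    if n <= l.+1 then num_dfs_trees l n else num_dfs_trees l n + 1.
Proof.
case: n hn => // m _; rewrite ltnS num_dfs_treesE.
have [g [g_bij edgeE]] := directed_path_level hG.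
have g_inj := bij_inj g_bij.
have g_surj k : exists u, g u = k by case: g_bij => v _ gK; exists (v k).
pose op (s : m.+1.-tuple 'I_l.+1) := path_op g m (nth 0 (map val s)).
pose none : {ffun {ffun 'I_m.+1 -> option V} -> option V} := [ffun=> None].
have op_none : none \notin op @: bounded_depth_seqs l m.
  apply/imsetP => -[s /bounded_depth_seqP [s0 _] none_s].
  have [h hP] := path_op_witness g_surj s0 (fun i : 'I_m.+1 => nth_bounded s i).
  by have := proj2 (hP _) (fun=> erefl); rewrite -/(op s) -none_s ffunE.
have card_op : #|op @: bounded_depth_seqs l m| = #|bounded_depth_seqs l m|.
  apply: card_in_imset => s s' /bounded_depth_seqP [s0 _].
  move=> _ eq_op.
  have [h hP] := path_op_witness g_surj s0 (fun i : 'I_m.+1 => nth_bounded s i).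
  apply/esym/eq_from_depths/hP.
  by rewrite -/(op s') -eq_op; apply/(hP (nth 0 (map val s))).
(* Depth sequences that are not bounded by [l] contribute only [none], and
   they exist only if [m > l]. *)
have spectrumE : [set f | `[< exists2 t : term 'I_m.+1, bracketing t
                                 & f = term_op (graph_op E) t >]] =
    if m <= l then op @: bounded_depth_seqs l m
    else none |: op @: bounded_depth_seqs l m.
  apply/setP => f; rewrite inE; apply/asboolP/idP.
    move=> /(term_ops_path f g_inj edgeE) [s [sz ds] ->].
    have [/(has_nthP 0)[i lti ltl]|/hasPn H] := boolP (has (fun d => l < d) s).
      rewrite sz in lti.
      have -> : path_op g m (nth 0 s) = none :=
        path_op_None g (i := Ordinal lti) ltl.
      rewrite leqNgt (leq_trans ltl) ?setU11 //.
      exact: leq_trans (depth_seq_nth_le i ds) _.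
    have [s' sE] : exists s' : m.+1.-tuple 'I_l.+1, map val s' = s.
      apply: bounded_tuple => // i lti; rewrite leqNgt.
      by apply/H/mem_nth; rewrite sz.
    have : op s' \in op @: bounded_depth_seqs l m.
      by apply: imset_f; rewrite inE sE.
    by rewrite /op sE => H'; case: ifP => // _; rewrite inE H' orbT.
  move=> fin; apply/(term_ops_path f g_inj edgeE).
  have imP : f \in op @: bounded_depth_seqs l m ->
      exists2 s, size s = m.+1 /\ depth_seq s & f = path_op g m (nth 0 s).
    move=> /imsetP[s]; rewrite inE => ds ->; exists (map val s) => //.
    by rewrite size_map size_tuple.
  case: leqP fin => [_ //|lm]; rewrite !inE => /orP[/eqP ->|//].
  exists (iota 0 m.+1); first by rewrite size_iota depth_seq_iota.
  by apply/esym/(path_op_None g (i := ord_max)); rewrite nth_iota.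
rewrite /assoc_spectrum spectrumE; case: leqP => _ //.
by rewrite cardsU1 op_none card_op addnC.
Qed.
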